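(* Let $E=TM\oplus T^*M\oplus\mathcal G$ be a standard Courant algebroid. There is a natural bijection between generalised almost complex structures $\mathcal J$ on $E$ and data $J\in\Gamma(\mathrm{End}\,TM)$, $A\in\Gamma(\mathrm{End}\,\mathcal G)$, $B:T^*M\to TM$, $\nu:T^*M\to\mathcal G$, $C:TM\to T^*M$, $\mu:TM\to\mathcal G$ subject to the skew-symmetry conditions $$B^*=-B,\quad C^*=-C,\quad A^*=-A$$ and the quadratic equations $$J^2+BC-\nu^*\mu=-\mathrm{Id}_{TM},$$ $$-\mu\nu^*-\nu\mu^*+A^2=-\mathrm{Id}_{\mathcal G},$$ $$JB-BJ^*-\nu^*\nu=0,$$ $$\mu B-\nu J^*+A\nu=0,$$ $$CJ-J^*C-\mu^*\mu=0,$$ $$\mu J+\nu C+A\mu=0.$$ Here $J^*:T^*M\to T^*M$, $A^*:\mathcal G\to\mathcal G$, $\nu^*:\mathcal G\to TM$, $\mu^*:\mathcal G\to T^*M$, $B^*:T^*M\to TM$ and $C^*:TM\to T^*M$ are the metric adjoints with respect to the scalar product on $E$.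
   Context: $M$ is a connected smooth manifold. $\mathcal G\to M$ is a bundle of quadratic Lie algebras with fibrewise scalar product (non-degenerate symmetric bilinear form) $\langle\cdot,\cdot\rangle_{\mathcal G}$, and the scalar product of the standard Courant algebroid $E=TM\oplus T^*M\oplus\mathcal G$ is $\langle X+\xi+r,Y+\eta+\tilde r\rangle=\frac12(\eta(X)+\xi(Y))+\langle r,\tilde r\rangle_{\mathcal G}$ (the bracket of $E$ plays no role in this statement). Unless otherwise stated Courant algebroids are of neutral signature. A generalised almost complex structure on $E$ is a smooth $\mathcal J\in\Gamma(\mathrm{End}\,E)$, skew-symmetric for $\langle\cdot,\cdot\rangle$, with $\mathcal J^2=-\mathrm{Id}$. The maps $J,A,B,C,\mu,\nu$ are smooth bundle maps. The adjoints are explicitly (for $X,Y\in TM$, $\xi,\eta\in T^*M$, $r,s\in\mathcal G$): $(J^*\xi)(X)=\xi(JX)$, $\eta(B^*\xi)=\xi(B\eta)$, $(C^*X)(Y)=(CY)(X)$, $\langle A^*r,s\rangle=\langle r,As\rangle$, $\langle\nu^*r,\xi\rangle=\langle r,\nu\xi\rangle$, $\langle\mu^*r,X\rangle=\langle r,\mu X\rangle$, the last two being with respect to the scalar product of $E$ (so $\xi(\nu^*r)=2\langle r,\nu\xi\rangle_{\mathcal G}$, $(\mu^*r)(X)=2\langle r,\mu X\rangle_{\mathcal G}$). The natural bijection is given by writing $\mathcal J$ as a block matrix with respect to $E=TM\oplus T^*M\oplus\mathcal G$: $$\mathcal J=\begin{pmatrix}J&B&-\nu^*\\ C&-J^*&-\mu^*\\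 \mu&\nu&A\end{pmatrix}.$$ *)

(* Defs.v *)
From HB Require Import structures.
From mathcomp Require Import all_boot all_order all_algebra.
From mathcomp Require Import all_classical all_reals all_analysis.
From mathcomp Require Import ring.

Set Implicit Arguments.
Unset Strict Implicit.
Unset Printing Implicit Defensive.

Import Order.TTheory GRing.Theory Num.Theory.
Import numFieldNormedType.Exports.

Local Open Scope classical_set_scope.
Local Open Scope ring_scope.

Section SmoothCalculus.
Variable R : realType.

Fixpoint diff_times (V W : normedModType R) (k : nat) (U : set V) (f : V -> W)
    : Prop :=
  if k is k'.+1 then
    (forall x, U x -> differentiable f x) /\
    (forall v, diff_times k' U (fun x => 'd f x v))
  else True.

(* f is C^oo on U, for U open: f is differentiable on U and so are all its
   iterated directional derivatives. *)
Definition smooth (V W : normedModType R) (U : set V) (f : V -> W) : Prop :=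
  forall k, diff_times k U f.

Lemma near_diff (V W : normedModType R) (f g : V -> W) (x : V) :
  {near x, f =1 g} -> differentiable f x ->
  differentiable g x /\ 'd g x = 'd f x :> (V -> W).
Proof.
move=> fg df; have /diff_locallyP[dfc fE] := df.
have gE : g \o shift x = cst (g x) + 'd f x +o_ 0 id.
  apply/eqaddoP => _/posnumP[e].
  have /eqaddoP/(_ _ [gt0 of e%:num]) := fE.
  have fgx : \forall h \near 0, f (h + x) = g (h + x).
    by move: fg; rewrite (near_shift 0 x) subr0.
  apply: filterS2 fgx => h fgh.
  by rewrite /= !fctE /= -fgh -(nbhs_singleton fg).
have dgE := diff_unique dfc gE.
split; last exact: dgE.
by apply/diff_locallyP; split; rewrite dgE; [exact: dfc | exact: gE].
Qed.

Lemma diff_times_le (V W : normedModType R) k (U : set V) (f : V -> W) :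
  diff_times k.+1 U f -> diff_times k U f.
Proof.
by elim: k f => [//|k IH] f [df d2]; split=> // v; exact: IH (d2 v).
Qed.

Lemma diff_times_sub (V W : normedModType R) k (U U' : set V) (f : V -> W) :
  U `<=` U' -> diff_times k U' f -> diff_times k U f.
Proof.
move=> UU'; elim: k f => [//|k IH] f [df d2]; split=> [x /UU'|v].
  exact: df.
exact: IH (d2 v).
Qed.

Lemma diff_times_eq (V W : normedModType R) k (U : set V) (f g : V -> W) :
  open U -> (forall x, U x -> f x = g x) -> diff_times k U f ->
  diff_times k U g.
Proof.
move=> oU; elim: k f g => [//|k IH] f g fg [df d2].
have near_fg x : U x -> {near x, f =1 g}.
  by move=> Ux; apply: filterS (open_nbhs_nbhs (conj oU Ux)) => y /fg.
split=> [x Ux|v]; first by have [] := near_diff (near_fg x Ux) (df x Ux).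
apply: IH (d2 v) => x Ux.
by have [_ ->] := near_diff (near_fg x Ux) (df x Ux).
Qed.

Lemma diff_times_cst (V W : normedModType R) k (U : set V) (w : W) :
  diff_times k U (cst w).
Proof.
elim: k w => [//|k IH] w; split=> [x _|v]; first exact: differentiable_cst.
rewrite (_ : (fun x => _) = cst 0) //; apply/funext => x.
by rewrite diff_cst.
Qed.

Lemma diff_timesD (V W : normedModType R) k (U : set V) (f g : V -> W) :
  open U -> diff_times k U f -> diff_times k U g -> diff_times k U (f + g).
Proof.
move=> oU; elim: k f g => [//|k IH] f g [df d2f] [dg d2g].
split=> [x Ux|v]; first by apply: differentiableD; [exact: df | exact: dg].
apply: diff_times_eq oU _ (IH _ _ (d2f v) (d2g v)) => x Ux.
by rewrite diffD//; [exact: df | exact: dg].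
Qed.

Lemma diff_times_sum (V W : normedModType R) k (U : set V) n
    (f : 'I_n -> V -> W) :
  open U -> (forall i, diff_times k U (f i)) -> diff_times k U (\sum_i f i).
Proof.
move=> oU df; elim/big_ind : _ => //; first exact: diff_times_cst.
by move=> g h; exact: diff_timesD.
Qed.

Lemma diff_timesM (V : normedModType R) k (U : set V) (f g : V -> R) :
  open U -> diff_times k U f -> diff_times k U g -> diff_times k U (f * g).
Proof.
move=> oU; elim: k f g => [//|k IH] f g df' dg'.
have [df d2f] := df'; have [dg d2g] := dg'.
split=> [x Ux|v]; first by apply: differentiableM; [exact: df | exact: dg].
have := diff_timesD oU (IH _ _ (diff_times_le df') (d2g v))
                       (IH _ _ (diff_times_le dg') (d2f v)).
apply: diff_times_eq => // x Ux.
by rewrite diffM//; [exact: df | exact: dg].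
Qed.

Lemma diff_times_linear (V W W' : normedModType R) k (U : set V) (f : V -> W)
    (L : {linear W -> W'}) :
  open U -> continuous L -> diff_times k U f -> diff_times k U (L \o f).
Proof.
move=> oU cL; elim: k f => [//|k IH] f [df d2f]; split=> [x Ux|v].
  by apply: differentiable_comp; [exact: df | exact: linear_differentiable].
apply: diff_times_eq oU _ (IH _ (d2f v)) => x Ux.
rewrite diff_comp /=; first by rewrite diff_lin.
- exact: df.
- exact: linear_differentiable.
Qed.

Definition coordl n (i : 'I_n) (u : 'rV[R]_n) : R := u 0 i.
Fact coordl_linear n (i : 'I_n) : linear (@coordl n i).
Proof. by move=> a u v; rewrite /coordl !mxE. Qed.
HB.instance Definition _ n (i : 'I_n) :=
  GRing.isLinear.Build R 'rV[R]_n R _ (@coordl n i) (@coordl_linear n i).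

Lemma diff_times_coord (V : normedModType R) n k (U : set V)
    (f : V -> 'rV[R]_n) (i : 'I_n) :
  open U -> diff_times k U f -> diff_times k U (fun x => f x 0 i).
Proof.
move=> oU; apply: (@diff_times_linear _ _ _ k U f (@coordl n i)) => //.
exact: coord_continuous.
Qed.

Lemma diff_times_comp (V : normedModType R) n k (U : set V) (U' : set 'rV[R]_n)
    (f : V -> 'rV[R]_n) (g : 'rV[R]_n -> R) :
  open U -> (forall x, U x -> U' (f x)) ->
  diff_times k U f -> diff_times k U' g -> diff_times k U (g \o f).
Proof.
move=> oU UU'; elim: k g => [//|k IH] g df' dg'.
have [df d2f] := df'; have [dg d2g] := dg'.
split=> [x Ux|v].
  by apply: differentiable_comp; [exact: df | exact/dg/UU'].
pose h : V -> R := \sum_j ((fun x => 'd g (f x) (delta_mx 0 j)) *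
                           (fun x => ('d f x v) 0 j)).
apply: (@diff_times_eq _ _ _ _ h) => // [x Ux|].
  rewrite diff_comp /=; [|exact: df|exact/dg/UU'].
  rewrite [in RHS](row_sum_delta ('d f x v)) linear_sum /h fct_sumE.
  apply: eq_bigr => j _; rewrite [RHS]linearZ.
  exact: mulrC.
apply: diff_times_sum => // j; apply: diff_timesM => //.
  exact: (IH (fun y => 'd g y (delta_mx 0 j)) (diff_times_le df') (d2g _)).
exact: diff_times_coord (d2f v).
Qed.

End SmoothCalculus.

(* A C^oo manifold of dimension n, given by a (not necessarily maximal) smooth
   atlas; cmap c and cinv c are total functions, meaningful on cdom c and on its
   image. By cimg_open, cmap c is open onto an open subset of R^n, i.e. cinv c is
   continuous there. *)
Record manifold (R : realType) (n : nat) := Manifold {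
  carrier :> topologicalType;
  chart : Type;
  cdom : chart -> set carrier;
  cmap : chart -> carrier -> 'rV[R]_n;
  cinv : chart -> 'rV[R]_n -> carrier;
  manifold_hausdorff : hausdorff_space carrier;
  manifold_second_countable : @second_countable carrier;
  chart_cover : forall x, exists c, cdom c x;
  cdom_open : forall c, open (cdom c);
  cimg_open : forall c (U : set carrier), open U -> U `<=` cdom c ->
    open (cmap c @` U);
  cmap_continuous : forall c, {in cdom c, continuous (cmap c)};
  cmapK : forall c, {in cdom c, cancel (cmap c) (cinv c)};
  transition_smooth : forall c c',
    smooth (cmap c @` (cdom c `&` cdom c')) (cmap c' \o cinv c)
}.
Arguments cdom {R n m}.
Arguments cmap {R n m}.
Arguments cinv {R n m}.

Section SmoothFunctions.
Variables (R : realType) (n : nat) (M : manifold R n).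

Definition smooth_on (U : set M) (f : M -> R) : Prop :=
  forall c, smooth (cmap c @` (U `&` cdom c)) (f \o cinv c).

Lemma cmap_inj c (x y : M) :
  cdom c x -> cdom c y -> cmap c x = cmap c y -> x = y.
Proof.
by move=> cx cy xy; rewrite -(cmapK (mem_set cx)) xy cmapK// inE.
Qed.

Lemma smooth_on_sub (U U' : set M) f :
  U `<=` U' -> smooth_on U' f -> smooth_on U f.
Proof.
move=> UU' sf c k; apply: diff_times_sub (sf c k).
by apply: image_subset => x [/UU'].
Qed.

Lemma smooth_on_eq (U : set M) f g :
  open U -> (forall x, U x -> f x = g x) -> smooth_on U f -> smooth_on U g.
Proof.
move=> oU fg sf c k; apply: diff_times_eq (sf c k).
  by apply: cimg_open => [|x []//]; apply: openI => //; exact: cdom_open.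
by move=> _ [x [Ux cx] <-] /=; rewrite cmapK ?inE// fg.
Qed.

Lemma smooth_on_cst (U : set M) (a : R) : smooth_on U (cst a).
Proof. by move=> c k; exact: diff_times_cst. Qed.

End SmoothFunctions.

Section Bundles.
Variables (R : realType) (n : nat) (M : manifold R n).

(* A smooth vector bundle is given by its fibres and a vector bundle atlas: local
   trivialisations, linear bijections on fibres, with smooth transition
   matrices. *)
Record vbundle := VBundle {
  fibre :> M -> vectType R;
  rank : nat;
  triv : Type;
  tdom : triv -> set M;
  tmap : forall (t : triv) (x : M), 'Hom(fibre x, 'rV[R]_rank);
  triv_cover : forall x, exists t, tdom t x;
  tdom_open : forall t, open (tdom t);
  tmap_bij : forall t x, tdom t x -> bijective (tmap t x);
  triv_smooth : forall t t' i j, smooth_on (tdom t `&` tdom t')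
    (fun x => (tmap t' x ((tmap t x)^-1%VF (delta_mx 0 i))) 0 j)
}.

(* Bundle maps over the identity, not necessarily smooth. *)
Definition bmap (V W : vbundle) : Type := forall x : M, 'Hom(V x, W x).

Definition frame (V : vbundle) (t : triv V) (i : 'I_(rank V)) (x : M) : V x :=
  (tmap t x)^-1%VF (delta_mx 0 i).

(* The matrix entries in local frames are smooth functions. *)
Definition smooth_bmap (V W : vbundle) (F : bmap V W) : Prop :=
  forall (t : triv V) (t' : triv W) i j, smooth_on (tdom t `&` tdom t')
    (fun x => (tmap t' x (F x (frame t i x))) 0 j).

Lemma bij_lfun_VK (U V : vectType R) (f : 'Hom(U, V)) :
  bijective f -> cancel (f^-1)%VF f.
Proof.
case=> g fK gK v; apply: limg_lfunVK.
by rewrite -(gK v) memv_img ?memvf.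
Qed.

Lemma bij_lfun_KV (U V : vectType R) (f : 'Hom(U, V)) :
  bijective f -> cancel f (f^-1)%VF.
Proof.
move=> [g fK _]; apply: lker0_lfunK; apply/lker0P; exact: can_inj fK.
Qed.

(* A tangent vector at x assigns to every chart around x a vector of R^n, these
   vectors being related by the differentials of the transition maps; the value
   at charts whose domain misses x is irrelevant, and set to 0. *)
Definition is_tangent (x : M) : pred (chart M -> 'rV[R]_n) := fun v =>
  `[< (forall c, ~ cdom c x -> v c = 0) /\
      (forall c c', cdom c x -> cdom c' x ->
         v c' = 'd (cmap c' \o cinv c) (cmap c x) (v c)) >].

Fact is_tangent_submod (x : M) : submod_closed (is_tangent x).
Proof.
split=> [|a u v /asboolP[u0 uT] /asboolP[v0 vT]]; apply/asboolP.
  by split=> // c c' _ _; rewrite [RHS]linear0.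
have E c : (a *: u + v) c = a *: u c + v c by [].
split=> [c xc|c c' xc xc']; first by rewrite E u0// v0// scaler0 addr0.
rewrite !E linearD; congr (_ + _); last exact: vT.
by rewrite linearZ (uT c c').
Qed.

HB.instance Definition _ x := GRing.isSubmodClosed.Build R _ (is_tangent x)
  (is_tangent_submod x).

Record tangent (x : M) := Tangent {
  tvec :> chart M -> 'rV[R]_n;
  tvecP : is_tangent x tvec
}.

HB.instance Definition _ (x : M) := [isSub for @tvec x].
HB.instance Definition _ (x : M) := [Choice of tangent x by <:].
HB.instance Definition _ (x : M) := [SubChoice_isSubLmodule of tangent x by <:].

Lemma transition_differentiable c c' (x : M) : cdom c x -> cdom c' x ->
  differentiable (cmap c' \o cinv c) (cmap c x).
Proof.
move=> cx c'x; have [df _] := transition_smooth c c' 1.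
by apply: df; exists x.
Qed.

Lemma diff_transition_id c (x : M) v :
  cdom c x -> 'd (cmap c \o cinv c) (cmap c x) v = v.
Proof.
move=> cx.
have idE : {near cmap c x, id =1 cmap c \o cinv c}.
  have oc : open (cmap c @` cdom c) by apply: cimg_open => //; exact: cdom_open.
  apply: filterS (open_nbhs_nbhs (conj oc (imageP _ cx))) => _ [y cy <-] /=.
  by rewrite cmapK ?inE.
have did : is_diff (cmap c x) id id by exact: is_diff_id.
have [_ ->] := near_diff idE (@ex_diff _ _ _ _ _ _ _ did).
by rewrite diff_val.
Qed.

Lemma diff_transition_comp c c' c'' (x : M) v :
  cdom c x -> cdom c' x -> cdom c'' x ->
  'd (cmap c'' \o cinv c') (cmap c' x) ('d (cmap c' \o cinv c) (cmap c x) v) =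
  'd (cmap c'' \o cinv c) (cmap c x) v.
Proof.
move=> cx c'x c''x.
set f := cmap c' \o cinv c; set g := cmap c'' \o cinv c'.
have fx : f (cmap c x) = cmap c' x by rewrite /f /= cmapK ?inE.
have df : differentiable f (cmap c x) by exact: transition_differentiable.
have dg : differentiable g (f (cmap c x)).
  by rewrite fx; exact: transition_differentiable.
have gfE : {near cmap c x, g \o f =1 cmap c'' \o cinv c}.
  have oc : open (cmap c @` (cdom c `&` cdom c')).
    by apply: cimg_open => [|y []//]; apply: openI; exact: cdom_open.
  have cc'x : (cmap c @` (cdom c `&` cdom c')) (cmap c x) by exists x.
  apply: filterS (open_nbhs_nbhs (conj oc cc'x)) => _ [y [cy c'y] <-].
  by rewrite /g /f /= (@cmapK _ _ _ c y) ?inE// cmapK ?inE.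
have [_ dE] := near_diff gfE (differentiable_comp df dg).
apply: (etrans _ (esym (congr1 (@^~ v) dE))).
apply: (etrans _ (esym (congr1 (@^~ v) (diff_comp df dg)))).
have aux p w : p = f (cmap c x) -> 'd g p w = 'd g (f (cmap c x)) w by move->.
exact/aux/esym.
Qed.

Definition tangent_of_chart_fun (x : M) c (w : 'rV[R]_n) (c' : chart M) :
    'rV[R]_n :=
  if `[< cdom c' x >] then 'd (cmap c' \o cinv c) (cmap c x) w else 0.

Fact tangent_of_chart_subproof (x : M) c (cx : cdom c x) w :
  is_tangent x (tangent_of_chart_fun x c w).
Proof.
apply/asboolP; split=> [c' c'x|c' c'' c'x c''x].
  by rewrite /tangent_of_chart_fun asboolF.
rewrite /tangent_of_chart_fun (asboolT c'x) (asboolT c''x).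
exact: esym (diff_transition_comp w cx c'x c''x).
Qed.

Definition tangent_of_chart (x : M) c (cx : cdom c x) w : tangent x :=
  Tangent (tangent_of_chart_subproof cx w).

Lemma tangent_of_chartK (x : M) c (cx : cdom c x) :
  cancel (tangent_of_chart cx) (fun v => v c).
Proof.
by move=> w; rewrite /= /tangent_of_chart_fun asboolT// diff_transition_id.
Qed.

Lemma tangent_chartK (x : M) c (cx : cdom c x) :
  cancel (fun v : tangent x => v c) (tangent_of_chart cx).
Proof.
move=> v; apply: val_inj; apply/funext => c' /=.
have /asboolP[v0 vT] := tvecP v.
rewrite /tangent_of_chart_fun; case: asboolP => [c'x|/v0 c'v].
  exact/esym/vT.
exact: esym c'v.
Qed.

Definition tangent_coord (x : M) c (v : tangent x) : 'rV[R]_n := v c.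
Fact tangent_coord_linear (x : M) c : linear (@tangent_coord x c).
Proof. by []. Qed.

Fact tangent_vect_iso (x : M) : Vector.axiom n (tangent x).
Proof.
have [c cx] := cid (chart_cover x).
exists (@tangent_coord x c); first exact: tangent_coord_linear.
by exists (tangent_of_chart cx);
  [exact: tangent_chartK | exact: tangent_of_chartK].
Qed.

HB.instance Definition _ (x : M) :=
  Lmodule_hasFinDim.Build R (tangent x) (tangent_vect_iso x).

HB.instance Definition _ (x : M) c := GRing.isLinear.Build R (tangent x)
  'rV[R]_n _ (@tangent_coord x c) (@tangent_coord_linear x c).

Definition tangent_triv (c : chart M) (x : M) : 'Hom(tangent x, 'rV[R]_n) :=
  linfun (@tangent_coord x c).

Lemma tangent_trivE c (x : M) v : tangent_triv c x v = v c.
Proof. by rewrite lfunE. Qed.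

Fact tangent_triv_bij c (x : M) : cdom c x -> bijective (tangent_triv c x).
Proof.
move=> cx; exists (tangent_of_chart cx) => [v|w]; rewrite tangent_trivE.
  exact: tangent_chartK.
exact: tangent_of_chartK.
Qed.

Lemma tangent_triv_inv c (x : M) (cx : cdom c x) w :
  (tangent_triv c x)^-1%VF w = tangent_of_chart cx w.
Proof.
rewrite -{1}(tangent_of_chartK cx w) -tangent_trivE bij_lfun_KV//.
exact: tangent_triv_bij.
Qed.

Fact tangent_triv_smooth c c' i j : smooth_on (cdom c `&` cdom c')
  (fun x => (tangent_triv c' x ((tangent_triv c x)^-1%VF (delta_mx 0 i))) 0 j).
Proof.
have oD c1 c2 : open (cdom c1 `&` cdom c2 : set M).
  by apply: openI; exact: cdom_open.
pose f y := ('d (cmap c' \o cinv c) y (delta_mx 0 i)) 0 j.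
apply: (@smooth_on_eq _ _ _ _ (f \o cmap c)) => // [x [cx c'x]|d k].
  rewrite tangent_triv_inv tangent_trivE /= /tangent_of_chart_fun.
  by rewrite (asboolT c'x).
have oV : open (cmap c @` (cdom c `&` cdom c')).
  by apply: cimg_open => // x [].
have oU : open (cmap d @` (cdom c `&` cdom c' `&` cdom d)).
  apply: cimg_open => [|x [] //]; apply: openI => //; exact: cdom_open.
rewrite -compA.
apply: (@diff_times_comp _ _ _ _ _ (cmap c @` (cdom c `&` cdom c'))) => //.
- by move=> _ [x [xc dx] <-]; exists x => //=; rewrite cmapK ?inE.
- apply: diff_times_sub (transition_smooth d c k).
  by apply: image_subset => x [[cx _] dx].
- apply: diff_times_coord => //.
  by have [_ /(_ (delta_mx 0 i))] := transition_smooth c c' k.+1.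
Qed.

Definition tangent_bundle : vbundle :=
  @VBundle tangent n (chart M) cdom tangent_triv (@chart_cover _ _ M)
    (@cdom_open _ _ M) tangent_triv_bij tangent_triv_smooth.

Section Dual.
Variable V : vbundle.

Definition dual_coord (t : triv V) (x : M) (xi : 'Hom(V x, R^o)) :
  'rV[R]_(rank V) := \row_i xi (frame t i x).
Fact dual_coord_linear t x : linear (@dual_coord t x).
Proof. by move=> a xi eta; apply/rowP => i; rewrite !mxE !lfunE /= lfunE. Qed.
HB.instance Definition _ t x := GRing.isLinear.Build R 'Hom(V x, R^o)
  'rV[R]_(rank V) _ (@dual_coord t x) (@dual_coord_linear t x).

(* The frame induced on the dual is the dual frame. *)
Definition dual_triv (t : triv V) (x : M) :
  'Hom('Hom(V x, R^o), 'rV[R]_(rank V)) := linfun (@dual_coord t x).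

Lemma dual_trivE t x xi i : dual_triv t x xi 0 i = xi (frame t i x).
Proof. by rewrite lfunE mxE. Qed.

Lemma frame_expand t (x : M) (v : V x) :
  tdom t x -> v = \sum_i (tmap t x v) 0 i *: frame t i x.
Proof.
move=> tx; rewrite -[LHS](bij_lfun_KV (tmap_bij tx)).
rewrite [in LHS](row_sum_delta (tmap t x v)) linear_sum.
by apply: eq_bigr => i _; rewrite linearZ.
Qed.

Fact dual_triv_bij t x : tdom t x -> bijective (dual_triv t x).
Proof.
move=> tx.
pose g (w : 'rV[R]_(rank V)) : 'Hom(V x, R^o) :=
  \sum_i w 0 i *: (linfun (@coordl R _ i : _ -> R^o) \o tmap t x)%VF.
have gE w v : g w v = \sum_i w 0 i * (tmap t x v) 0 i.
  rewrite sum_lfunE; apply: eq_bigr => i _.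
  by rewrite scale_lfunE comp_lfunE lfunE.
have gK w j : g w (frame t j x) = w 0 j.
  rewrite gE (bigD1 j)//= big1 ?addr0 => [|i ij].
    by rewrite /frame (bij_lfun_VK (tmap_bij tx)) mxE !eqxx mulr1.
  by rewrite /frame (bij_lfun_VK (tmap_bij tx)) mxE (negPf ij) andbF mulr0.
exists g => [xi|w]; last by apply/rowP => i; rewrite dual_trivE gK.
apply/lfunP => v; rewrite [in RHS](frame_expand v tx) linear_sum gE.
by apply: eq_bigr => i _; rewrite linearZ dual_trivE mulrC.
Qed.

Fact dual_triv_smooth t t' i j : smooth_on (tdom t `&` tdom t')
  (fun x => (dual_triv t' x ((dual_triv t x)^-1%VF (delta_mx 0 i))) 0 j).
Proof.
apply: (@smooth_on_eq _ _ _ _ (fun x => tmap t x (frame t' j x) 0 i)).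
- by apply: openI; exact: tdom_open.
- move=> x [tx t'x]; rewrite dual_trivE.
  set xi := ((dual_triv t x)^-1)%VF _.
  have xiE k : xi (frame t k x) = (delta_mx 0 i : 'rV_(rank V)) 0 k.
    by rewrite -dual_trivE (bij_lfun_VK (dual_triv_bij tx)).
  rewrite [in RHS](frame_expand (frame t' j x) tx) linear_sum.
  rewrite (bigD1 i)//= big1 ?addr0 => [|k ki]; rewrite linearZ /= xiE mxE eqxx /=.
    by rewrite eqxx [RHS]mulr1.
  by rewrite (negPf ki) [LHS]mulr0.
- by rewrite setIC; exact: triv_smooth.
Qed.

Definition dual_bundle : vbundle :=
  @VBundle (fun x => 'Hom(V x, R^o)) (rank V) (triv V) (@tdom V) dual_triv
    (@triv_cover V) (@tdom_open V) dual_triv_bij dual_triv_smooth.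

End Dual.

Section Sum.
Variables V W : vbundle.

Definition sum_coord (t : triv V * triv W) (x : M) (u : V x * W x) :
  'rV[R]_(rank V + rank W) := row_mx (tmap t.1 x u.1) (tmap t.2 x u.2).
Fact sum_coord_linear t x : linear (@sum_coord t x).
Proof.
by move=> a u v; rewrite /sum_coord !linearP scale_row_mx add_row_mx.
Qed.
HB.instance Definition _ t x := GRing.isLinear.Build R (V x * W x)%type
  'rV[R]_(rank V + rank W) _ (@sum_coord t x) (@sum_coord_linear t x).

Definition sum_triv (t : triv V * triv W) (x : M) :
  'Hom((V x * W x)%type, 'rV[R]_(rank V + rank W)) := linfun (@sum_coord t x).

Definition sum_dom (t : triv V * triv W) : set M := tdom t.1 `&` tdom t.2.

Lemma sum_trivE t x u :
  sum_triv t x u = row_mx (tmap t.1 x u.1) (tmap t.2 x u.2).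
Proof. by rewrite lfunE. Qed.

Fact sum_cover x : exists t, sum_dom t x.
Proof.
have [t tx] := @triv_cover V x; have [t' t'x] := @triv_cover W x.
by exists (t, t').
Qed.

Fact sum_dom_open t : open (sum_dom t).
Proof. by apply: openI; exact: tdom_open. Qed.

Definition sum_triv_inv (t : triv V * triv W) x (w : 'rV[R]_(rank V + rank W)) :
  V x * W x := ((tmap t.1 x)^-1%VF (lsubmx w), (tmap t.2 x)^-1%VF (rsubmx w)).

Lemma sum_trivK t x : sum_dom t x -> cancel (sum_triv t x) (sum_triv_inv t x).
Proof.
move=> [tx t'x] [v w]; rewrite sum_trivE /sum_triv_inv row_mxKl row_mxKr.
by rewrite !bij_lfun_KV//; exact: tmap_bij.
Qed.

Lemma sum_triv_invK t x : sum_dom t x -> cancel (sum_triv_inv t x) (sum_triv t x).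
Proof.
move=> [tx t'x] w; rewrite sum_trivE /= !bij_lfun_VK ?hsubmxK//;
  exact: tmap_bij.
Qed.

Fact sum_triv_bij t x : sum_dom t x -> bijective (sum_triv t x).
Proof.
by move=> tx; exists (sum_triv_inv t x); [exact: sum_trivK|exact: sum_triv_invK].
Qed.

Lemma sum_triv_invE t x w : sum_dom t x ->
  (sum_triv t x)^-1%VF w = sum_triv_inv t x w.
Proof.
move=> tx; rewrite -{1}(sum_triv_invK tx w) bij_lfun_KV//.
exact: sum_triv_bij.
Qed.

Fact sum_triv_smooth t t' i j : smooth_on (sum_dom t `&` sum_dom t')
  (fun x => (sum_triv t' x ((sum_triv t x)^-1%VF (delta_mx 0 i))) 0 j).
Proof.
pose f x := sum_triv t' x (sum_triv_inv t x (delta_mx 0 i)) 0 j.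
have oD : open (sum_dom t `&` sum_dom t').
  by apply: openI; exact: sum_dom_open.
apply: (@smooth_on_eq _ _ _ _ f) => // [x [tx _]|].
  by rewrite sum_triv_invE.
rewrite /f; under eq_fun do rewrite sum_trivE /=.
case: (split_ordP i) => k ->; case: (split_ordP j) => l ->.
- rewrite delta_mx_lshift; under eq_fun do rewrite row_mxEl row_mxKl.
  apply: smooth_on_sub (triv_smooth t.1 t'.1 k l).
  by move=> x [[? ?] [? ?]].
- rewrite delta_mx_lshift; under eq_fun do rewrite row_mxEr row_mxKr linear0 linear0 mxE.
  exact: smooth_on_cst.
- rewrite delta_mx_rshift; under eq_fun do rewrite row_mxEl row_mxKl linear0 linear0 mxE.
  exact: smooth_on_cst.
- rewrite delta_mx_rshift; under eq_fun do rewrite row_mxEr row_mxKr.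
  apply: smooth_on_sub (triv_smooth t.2 t'.2 k l).
  by move=> x [[? ?] [? ?]].
Qed.

Definition sum_bundle : vbundle :=
  @VBundle (fun x => (V x * W x)%type) (rank V + rank W) (triv V * triv W)%type
    sum_dom sum_triv sum_cover sum_dom_open sum_triv_bij sum_triv_smooth.

End Sum.

(* Bilinear operations on the fibres are curried linear maps. *)
Record quadratic_lie_bundle := QuadraticLieBundle {
  qbundle :> vbundle;
  qlie : forall x, 'Hom(qbundle x, 'Hom(qbundle x, qbundle x));
  qform : bmap qbundle (dual_bundle qbundle);
  qlie_smooth : forall (t : triv qbundle) i j k, smooth_on (tdom t)
    (fun x => (tmap t x (qlie x (frame t i x) (frame t j x))) 0 k);
  qform_smooth : smooth_bmap qform;
  qlie_alt : forall x (r : qbundle x), qlie x r r = 0;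
  qlie_jacobi : forall x (r s t : qbundle x),
    qlie x r (qlie x s t) + qlie x s (qlie x t r) + qlie x t (qlie x r s) = 0;
  qform_sym : forall x (r s : qbundle x), qform x r s = qform x s r;
  qform_nondegenerate : forall x (r : qbundle x),
    (forall s, qform x r s = 0) -> r = 0;
  qform_invariant : forall x (r s t : qbundle x),
    qform x (qlie x r s) t + qform x s (qlie x r t) = 0
}.

End Bundles.

(* For b symmetric: there are a positive definite and a negative definite
   subspace, of the same dimension, spanning V. *)
Definition neutral_signature (R : realType) (V : vectType R) (b : V -> V -> R)
    : Prop :=
  exists P N : {vspace V},
    [/\ (P + N = fullv)%VS, \dim P = \dim N,
        forall v, v \in P -> v != 0 -> 0 < b v v &
        forall v, v \in N -> v != 0 -> b v v < 0].

Section Generalised.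
Variables (R : realType) (n : nat) (M : manifold R n).
Variable G : quadratic_lie_bundle M.

Definition courant_bundle : vbundle M :=
  sum_bundle (sum_bundle (tangent_bundle M) (dual_bundle (tangent_bundle M))) G.

Local Notation T := (tangent_bundle M).
Local Notation Ts := (dual_bundle T).
Local Notation E := courant_bundle.

Definition inT x (X : T x) : E x := (X, 0, 0).
Definition inTs x (xi : Ts x) : E x := (0, xi, 0).
Definition inG x (r : G x) : E x := (0, 0, r).

Definition courant_form x (u v : E x) : R :=
  2^-1 * (v.1.2 u.1.1 + u.1.2 v.1.1) + qform G x u.2 v.2.

(* V, W (resp. V', W') are summands of E, V' and W' being those which pair
   nondegenerately with V and W. The default value 0 is never used, see
   adj_JE to adj_muE below. *)
Definition metric_adjoint x (V W V' W' : vectType R)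
    (iV : V -> E x) (iW : W -> E x) (iV' : V' -> E x) (iW' : W' -> E x)
    (L : 'Hom(V, W)) : 'Hom(W', V') :=
  xget 0 [set L' : 'Hom(W', V') | forall w' v,
    courant_form (iV' (L' w')) (iV v) = courant_form (iW' w') (iW (L v))].

Definition adj_J (J : bmap T T) : bmap Ts Ts := fun x =>
  metric_adjoint (@inT x) (@inT x) (@inTs x) (@inTs x) (J x).
Definition adj_A (A : bmap G G) : bmap G G := fun x =>
  metric_adjoint (@inG x) (@inG x) (@inG x) (@inG x) (A x).
Definition adj_B (B : bmap Ts T) : bmap Ts T := fun x =>
  metric_adjoint (@inTs x) (@inT x) (@inT x) (@inTs x) (B x).
Definition adj_C (C : bmap T Ts) : bmap T Ts := fun x =>
  metric_adjoint (@inT x) (@inTs x) (@inTs x) (@inT x) (C x).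
Definition adj_nu (nu : bmap Ts G) : bmap G T := fun x =>
  metric_adjoint (@inTs x) (@inG x) (@inT x) (@inG x) (nu x).
Definition adj_mu (mu : bmap T G) : bmap G Ts := fun x =>
  metric_adjoint (@inT x) (@inG x) (@inTs x) (@inG x) (mu x).

Definition gen_almost_complex (I : bmap E E) : Prop :=
  [/\ smooth_bmap I,
      forall x (u v : E x), courant_form (I x u) v = - courant_form u (I x v) &
      forall x, (I x \o I x = - \1)%VF].

Record block_data := BlockData {
  dJ : bmap T T;
  dA : bmap G G;
  dB : bmap Ts T;
  dnu : bmap Ts G;
  dC : bmap T Ts;
  dmu : bmap T G
}.

Definition block_admissible (d : block_data) : Prop :=
  let: BlockData J A B nu C mu := d in
  let Js := adj_J J in let nus := adj_nu nu in let mus := adj_mu mu in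
  [/\ [/\ smooth_bmap J, smooth_bmap A & smooth_bmap B] /\
      [/\ smooth_bmap nu, smooth_bmap C & smooth_bmap mu],
      [/\ forall x, adj_B B x = - B x,
          forall x, adj_C C x = - C x &
          forall x, adj_A A x = - A x],
      [/\ forall x, (J x \o J x) + (B x \o C x) - (nus x \o mu x) = - \1,
          forall x, - (mu x \o nus x) - (nu x \o mus x) + (A x \o A x) = - \1 &
          forall x, (J x \o B x) - (B x \o Js x) - (nus x \o nu x) = 0]%VF &
      [/\ forall x, (mu x \o B x) - (nu x \o Js x) + (A x \o nu x) = 0,
          forall x, (C x \o J x) - (Js x \o C x) - (mus x \o mu x) = 0 &
          forall x, (mu x \o J x) + (nu x \o C x) + (A x \o mu x) = 0]%VF].

Definition block_fun (d : block_data) x (u : E x) : E x :=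
  let: BlockData J A B nu C mu := d in
  let: (X, xi, r) := u in
  (J x X + B x xi - adj_nu nu x r,
   C x X - adj_J J x xi - adj_mu mu x r,
   mu x X + nu x xi + A x r).

Definition block_endo (d : block_data) : bmap E E :=
  fun x => linfun (@block_fun d x).

End Generalised.

Arguments gen_almost_complex {R n M} G I.
Arguments block_admissible {R n M} G d.
Arguments block_endo {R n M} G d.
Arguments inT {R n M} G {x} X.
Arguments inTs {R n M} G {x} xi.
Arguments inG {R n M} G {x} r.

Section AdjointFormulas.
Variables (R : realType) (n : nat) (M : manifold R n).
Variable G : quadratic_lie_bundle M.
Local Notation T := (tangent_bundle M).
Local Notation Ts := (dual_bundle T).
Local Notation E := (courant_bundle G).

Lemma linfun_linearE (U V : vectType R) (f : U -> V) : linear f ->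
  linfun f =1 f.
Proof.
move=> lf u; pose g : {linear U -> V} := HB.pack f (GRing.isLinear.Build R U V _ f lf).
exact: (lfunE g).
Qed.

Lemma block_endoE (d : block_data G) x (u : E x) : block_endo G d x u = block_fun d u.
Proof.
have lin3 (W : lmodType R) a (p q r p' q' r' : W) :
    (a *: p + p') + (a *: q + q') + (a *: r + r') =
    a *: (p + q + r) + (p' + q' + r').
  rewrite !scalerDr [X in X + _ = _]addrACA.
  by rewrite [LHS]addrACA.
apply: linfun_linearE => a [[X xi] r] [[Y eta] s].
case: d => J A B nu C mu /=; rewrite !linearP.
by apply: congr2; first apply: congr2; exact: lin3.
Qed.

Lemma representable (V V' : vectType R) (p : V' -> V -> R) :
  (forall v', linear (p v' : V -> R^o)) ->
  (forall v, linear (fun v' => p v' v : R^o)) ->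
  (forall v', (forall v, p v' v = 0) -> v' = 0) -> dim V' = dim V ->
  forall phi : 'Hom(V, R^o), exists v', forall v, p v' v = phi v.
Proof.
move=> pr pl p_nd dimV phi.
pose P v' : 'Hom(V, R^o) := linfun (p v').
have PE v' v : P v' v = p v' v by exact: linfun_linearE.
have Plin : linear P.
  by move=> a u w; apply/lfunP => v; rewrite add_lfunE scale_lfunE !PE; exact: pl.
have kerP : lker (linfun P) == 0%VS.
  rewrite -subv0; apply/subvP => v'; rewrite memv_ker memv0 linfun_linearE//.
  move=> /eqP Pv'; apply/eqP/p_nd => v; rewrite -PE Pv'; exact: zero_lfunE.
have imP : limg (linfun P) = fullv.
  apply/eqP; rewrite eqEdim subvf /= limg_dim_eq; last first.
    by rewrite (eqP kerP) capv0.
  by rewrite !dimvf dimV [dim 'Hom(V, R^o)]muln1.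
have /memv_imgP[v' _ phiE] : phi \in limg (linfun P) by rewrite imP memvf.
by exists v' => v; rewrite phiE linfun_linearE// PE.
Qed.

Lemma metric_adjointE x (V W V' W' : vectType R)
    (iV : V -> E x) (iW : W -> E x) (iV' : V' -> E x) (iW' : W' -> E x) L :
  linear iV -> linear iW -> linear iV' -> linear iW' -> dim V' = dim V ->
  (forall v', (forall v, courant_form (iV' v') (iV v) = 0) -> v' = 0) ->
  forall w' v, courant_form (iV' (metric_adjoint iV iW iV' iW' L w')) (iV v) =
               courant_form (iW' w') (iW (L v)).
Proof.
move=> iVl iWl iV'l iW'l dimV nd.
have aux (a h p q r p' q' r' : R) :
    h * ((a * p + p') + (a * q + q')) + (a * r + r') =
    a * (h * (p + q) + r) + (h * (p' + q') + r').
  by ring.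
have form_l a (u v w : E x) : courant_form (a *: u + w) v =
    a * courant_form u v + courant_form w v.
  rewrite /courant_form /= !linearP !add_lfunE !scale_lfunE.
  exact: aux.
have form_r a (u v w : E x) : courant_form v (a *: u + w) =
    a * courant_form v u + courant_form v w.
  rewrite /courant_form /= !linearP !add_lfunE !scale_lfunE.
  exact: aux.
pose p v' v := courant_form (iV' v') (iV v).
have pr v' : linear (p v' : V -> R^o) by move=> a u w; rewrite /p iVl form_r.
have pl v : linear (fun v' => p v' v : R^o).
  by move=> a u w; rewrite /p iV'l form_l.
have repr := representable pr pl nd dimV.
pose q w' : 'Hom(V, R^o) := linfun (fun v => courant_form (iW' w') (iW (L v)) : R^o).
have qE w' v : q w' v = courant_form (iW' w') (iW (L v)).
  by apply: linfun_linearE => a u w; rewrite linearP iWl form_r.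
pose N w' := projT1 (cid (repr (q w'))).
have NE w' v : p (N w') v = courant_form (iW' w') (iW (L v)).
  by rewrite -qE /N; case: cid.
have pZD a s t v : p (a *: s + t) v = a * p s v + p t v by exact: pl.
have Nlin : linear N.
  move=> a u w; apply/eqP; rewrite -subr_eq0 [X in X == _]addrC.
  rewrite -(scaleN1r (a *: N u + N w)); apply/eqP/nd => v.
  change (p (-1 *: (a *: N u + N w) + N (a *: u + w)) v = 0).
  by rewrite !pZD !NE iW'l form_l mulN1r addNr.
rewrite /metric_adjoint; case: xgetP => [L' _ //|/(_ (linfun N))[]].
by move=> w' v; rewrite linfun_linearE//; exact: NE.
Qed.

Lemma functional_sep (V : vectType R) (v : V) :
  (forall xi : 'Hom(V, R^o), xi v = 0) -> v = 0.
Proof.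
move=> v0; rewrite (coord_vbasis (memvf v)) big1// => i _.
have <- := linfun_linearE (f := coord (vbasis fullv) i : V -> R^o) _ v.
  by rewrite v0 scale0r.
by move=> a u w; rewrite linearP.
Qed.

Let inT_linear x : linear (@inT _ _ _ G x).
Proof. by move=> a u v; congr (_, _, _); rewrite /= scaler0 addr0. Qed.
Let inTs_linear x : linear (@inTs _ _ _ G x).
Proof. by move=> a u v; congr (_, _, _); rewrite /= scaler0 addr0. Qed.
Let inG_linear x : linear (@inG _ _ _ G x).
Proof. by move=> a u v; congr (_, _, _); rewrite /= scaler0 addr0. Qed.

Lemma form_T_Ts x (X : T x) (xi : Ts x) :
  courant_form (inT G X) (inTs G xi) = 2^-1 * xi X.
Proof. by rewrite /courant_form /= !linear0 !addr0. Qed.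

Lemma form_Ts_T x (X : T x) (xi : Ts x) :
  courant_form (inTs G xi) (inT G X) = 2^-1 * xi X.
Proof. by rewrite /courant_form /= !linear0 addr0 add0r. Qed.

Lemma form_G x (r s : G x) : courant_form (inG G r) (inG G s) = qform G x r s.
Proof. by rewrite /courant_form /= !linear0 !addr0 mulr0 add0r. Qed.

Let dim_Ts x : dim (Ts x) = dim (T x).
Proof. exact: muln1. Qed.

Lemma nd_Ts x (xi : Ts x) :
  (forall X : T x, courant_form (inTs G xi) (inT G X) = 0) -> xi = 0.
Proof.
move=> xi0; apply/lfunP => X; rewrite zero_lfunE.
have /eqP := xi0 X; rewrite form_Ts_T mulf_eq0 invr_eq0 pnatr_eq0 /=.
exact: eqP.
Qed.

Lemma nd_T x (X : T x) :
  (forall xi : Ts x, courant_form (inT G X) (inTs G xi) = 0) -> X = 0.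
Proof.
move=> X0; apply: functional_sep => xi.
have /eqP := X0 xi; rewrite form_T_Ts mulf_eq0 invr_eq0 pnatr_eq0 /=.
exact: eqP.
Qed.

Lemma nd_G x (r : G x) :
  (forall s : G x, courant_form (inG G r) (inG G s) = 0) -> r = 0.
Proof.
by move=> r0; apply: qform_nondegenerate => s; rewrite -form_G.
Qed.

Let half_inj (a b : R) : 2^-1 * a = 2^-1 * b -> a = b.
Proof. by apply: mulfI; rewrite invr_eq0 pnatr_eq0. Qed.

Let half_eq (a b : R) : 2^-1 * a = b -> a = 2 * b.
Proof. by move=> <-; rewrite mulrA divff ?mul1r ?pnatr_eq0. Qed.

Lemma adj_JE (J : bmap T T) x (xi : Ts x) (X : T x) :
  adj_J G J x xi X = xi (J x X).
Proof.
apply: half_inj; rewrite -form_Ts_T -form_Ts_T.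
by apply: metric_adjointE => //; exact: nd_Ts.
Qed.

Lemma adj_AE (A : bmap G G) x (r s : G x) :
  qform G x (adj_A A x r) s = qform G x r (A x s).
Proof.
by rewrite -!form_G; apply: metric_adjointE => //; exact: nd_G.
Qed.

Lemma adj_BE (B : bmap Ts T) x (xi eta : Ts x) :
  eta (adj_B G B x xi) = xi (B x eta).
Proof.
apply: half_inj; rewrite -form_T_Ts -form_Ts_T.
by apply: metric_adjointE => //; exact: nd_T.
Qed.

Lemma adj_CE (C : bmap T Ts) x (X Y : T x) :
  adj_C G C x X Y = C x Y X.
Proof.
apply: half_inj; rewrite -form_Ts_T -form_T_Ts.
by apply: metric_adjointE => //; exact: nd_Ts.
Qed.

Lemma adj_nuE (nu : bmap Ts G) x (r : G x) (xi : Ts x) :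
  xi (adj_nu nu x r) = 2 * qform G x r (nu x xi).
Proof.
apply: half_eq; rewrite -form_T_Ts -form_G.
by apply: metric_adjointE => //; exact: nd_T.
Qed.

Lemma adj_muE (mu : bmap T G) x (r : G x) (X : T x) :
  adj_mu mu x r X = 2 * qform G x r (mu x X).
Proof.
apply: half_eq; rewrite -form_Ts_T -form_G.
by apply: metric_adjointE => //; exact: nd_Ts.
Qed.

End AdjointFormulas.

(* Main.v *)
Require Import Defs.
From mathcomp Require Import all_boot all_order all_algebra.
From mathcomp Require Import all_classical all_reals all_analysis.
From mathcomp Require Import lra.

Set Implicit Arguments.
Unset Strict Implicit.
Unset Printing Implicit Defensive.

Import Order.TTheory GRing.Theory Num.Theory.
Import numFieldNormedType.Exports.

Local Open Scope classical_set_scope.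
Local Open Scope ring_scope.

(** A bundle map [I] of [E = T + T^* + G] is a matrix of nine blocks, and a
    linear map on a fibre of [E] is determined by its values on the three
    summands. The correspondence then rests on three facts, one for each
    condition in the definition of a generalised almost complex structure.

    Skew-symmetry. The form pairs [T] with [T^*] and [G] with itself,
    nondegenerately in both cases. Testing skew-symmetry of [I] on pairs of
    summands therefore expresses each block through another one: the blocks
    T^* to T, T to T^* and G to G have to be skew, while the blocks
    [- J^*], [- nu^*] and [- mu^*] are determined by [J], [nu] and [mu]. Hence
    [block_endo] reaches every skew endomorphism ([skew_endo_block_endo]), and
    its values are skew exactly when [B], [C] and [A] are
    ([skew_block_endo]).

    The square. The equation [I^2 = - 1] has nine blocks, only six of which are
    required of the data. For skew [I] the square [I^2] is self-adjoint, so the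
    block from T^* to T^* is the adjoint of the one from T to T, and the blocks
    from G to T and to T^* are the adjoints of those from T^* and T to G: the
    other three equations follow from the six ([square_block_endo]).

    Smoothness. A map into or out of a direct sum is smooth if and only if its
    components are ([smooth_pair], [smooth_copair]), and the adjoint blocks
    inherit smoothness from [J], [nu] and [mu]: by the defining formulas, their
    entries in local frames are entries of [J], or polynomials in those of
    [nu], [mu] and of the scalar product of [G] ([smooth_block_endo]). *)

(** * Smooth functions *)

Section SmoothFunctions.
Variables (R : realType) (n : nat) (M : manifold R n).

(** Immediate because differentials are taken in the ambient space, not
    relative to [U]. *)
Lemma diff_times_local (V W : normedModType R) k (U : set V) (f : V -> W) :
  (forall x, U x -> exists2 U', U' x & diff_times k U' f) -> diff_times k U f.
Proof.
elim: k f => [//|k IH] f loc; split=> [x Ux|v].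
  by have [U' U'x [df _]] := loc x Ux; exact: df.
by apply: IH => x Ux; have [U' U'x [_ /(_ v)]] := loc x Ux; exists U'.
Qed.

Lemma smooth_on_local (U : set M) (f : M -> R) :
  (forall x, U x -> exists2 U', U' x & smooth_on U' f) -> smooth_on U f.
Proof.
move=> loc c k; apply: diff_times_local => _ [x [Ux cx] <-].
have [U' U'x sf] := loc x Ux.
by exists (cmap c @` (U' `&` cdom c)); [exists x | exact: sf].
Qed.

Lemma smooth_on_ext (U : set M) (f g : M -> R) :
  f =1 g -> smooth_on U f -> smooth_on U g.
Proof. by move/funext=> ->. Qed.

Lemma chart_image_open (U : set M) c : open U -> open (cmap c @` (U `&` cdom c)).
Proof.
move=> oU; apply: cimg_open => [|x []//]; apply: openI => //.
exact: cdom_open.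
Qed.

Lemma smooth_onM (U : set M) (f g : M -> R) : open U ->
  smooth_on U f -> smooth_on U g -> smooth_on U (fun x => f x * g x).
Proof.
move=> oU sf sg c k.
rewrite (_ : _ \o _ = (f \o cinv c) * (g \o cinv c)); last exact/funext.
exact: diff_timesM (chart_image_open oU) (sf c k) (sg c k).
Qed.

Lemma smooth_on_sum (U : set M) m (f : 'I_m -> M -> R) : open U ->
  (forall i, smooth_on U (f i)) -> smooth_on U (fun x => \sum_i f i x).
Proof.
move=> oU sf c k.
have := diff_times_sum (chart_image_open oU) (fun i => sf i c k).
rewrite (_ : \sum_i _ = (fun x => \sum_i f i x) \o cinv c)//.
by apply/funext => y; rewrite fct_sumE.
Qed.

End SmoothFunctions.

(** * Bundle maps into and out of a direct sum *)

Section SmoothBundleMaps.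
Variables (R : realType) (n : nat) (M : manifold R n).
Implicit Types V W Z : vbundle M.

Lemma entry_dom_open V W (t : triv V) (t' : triv W) :
  open (tdom t `&` tdom t').
Proof. by apply: openI; exact: tdom_open. Qed.

Lemma dual_frameE V (t : triv V) j x (v : V x) : tdom t x ->
  frame (V := dual_bundle V) t j x v = tmap t x v 0 j.
Proof.
move=> tx; set xi := frame _ _ _.
have xiE k : xi (frame t k x) = (delta_mx 0 j : 'rV_(rank V)) 0 k.
  by rewrite -dual_trivE (bij_lfun_VK (dual_triv_bij tx)).
rewrite [in LHS](frame_expand v tx) linear_sum (bigD1 j)//= big1 => [|k kj].
  by rewrite addr0 linearZ /= xiE mxE !eqxx; exact: mulr1.
by rewrite linearZ /= xiE mxE (negPf kj) andbF; exact: mulr0.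
Qed.

Lemma sum_frame_lshift V W (t : triv V) (t' : triv W) i x :
  tdom t x -> tdom t' x ->
  frame (V := sum_bundle V W) (t, t') (lshift _ i) x = (frame t i x, 0).
Proof.
move=> tx t'x; rewrite [LHS]sum_triv_invE// /sum_triv_inv.
by rewrite delta_mx_lshift row_mxKl row_mxKr linear0.
Qed.

Lemma sum_frame_rshift V W (t : triv V) (t' : triv W) i x :
  tdom t x -> tdom t' x ->
  frame (V := sum_bundle V W) (t, t') (rshift _ i) x = (0, frame t' i x).
Proof.
move=> tx t'x; rewrite [LHS]sum_triv_invE// /sum_triv_inv.
by rewrite delta_mx_rshift row_mxKl row_mxKr linear0.
Qed.

Definition pair_bmap Z V W (f : bmap Z V) (g : bmap Z W) :
    bmap Z (sum_bundle V W) :=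
  fun x => linfun (fun z => (f x z, g x z)).

Definition copair_bmap V W Z (f : bmap V Z) (g : bmap W Z) :
    bmap (sum_bundle V W) Z :=
  fun x => linfun (fun u => f x u.1 + g x u.2).

Lemma pair_bmapE Z V W (f : bmap Z V) (g : bmap Z W) x z :
  pair_bmap f g x z = (f x z, g x z).
Proof. by apply: linfun_linearE => a u v; rewrite !linearP. Qed.

Lemma copair_bmapE V W Z (f : bmap V Z) (g : bmap W Z) x u :
  copair_bmap f g x u = f x u.1 + g x u.2.
Proof.
by apply: linfun_linearE => a v w; rewrite !linearP scalerDr addrACA.
Qed.

(** A trivialisation of the sum is a pair of trivialisations, so an entry of
    [pair_bmap f g] is smooth on a smaller set than the corresponding entry of
    [f] has to be; smoothness of [f] is recovered locally, the trivialisation of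
    the other summand being chosen around each point. *)
Lemma smooth_pair Z V W (f : bmap Z V) (g : bmap Z W) :
  smooth_bmap (pair_bmap f g) <-> smooth_bmap f /\ smooth_bmap g.
Proof.
have entryl t (t1 : triv V) (t2 : triv W) i j x :
    tmap (v := sum_bundle V W) (t1, t2) x
      (pair_bmap f g x (frame t i x)) 0 (lshift _ j) =
    tmap t1 x (f x (frame t i x)) 0 j.
  by rewrite pair_bmapE [tmap _ _ _]sum_trivE row_mxEl.
have entryr t (t1 : triv V) (t2 : triv W) i j x :
    tmap (v := sum_bundle V W) (t1, t2) x
      (pair_bmap f g x (frame t i x)) 0 (rshift _ j) =
    tmap t2 x (g x (frame t i x)) 0 j.
  by rewrite pair_bmapE [tmap _ _ _]sum_trivE row_mxEr.
split=> [sfg|[sf sg] t [t1 t2] i j].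
  split=> t t' i j; apply: smooth_on_local => x [tx t'x].
    have [s sx] := triv_cover W x.
    exists (tdom t `&` (tdom t' `&` tdom s)) => //.
    by apply: smooth_on_ext (sfg t (t', s) i (lshift _ j)) => y; exact: entryl.
  have [s sx] := triv_cover V x.
  exists (tdom t `&` (tdom s `&` tdom t')) => //.
  by apply: smooth_on_ext (sfg t (s, t') i (rshift _ j)) => y; exact: entryr.
case: (split_ordP j) => k ->.
  apply: smooth_on_ext (smooth_on_sub _ (sf t t1 i k)) => [x|x [tx []]//].
  exact/esym/entryl.
apply: smooth_on_ext (smooth_on_sub _ (sg t t2 i k)) => [x|x [tx []]//].
exact/esym/entryr.
Qed.

Lemma smooth_copair V W Z (f : bmap V Z) (g : bmap W Z) :
  smooth_bmap (copair_bmap f g) <-> smooth_bmap f /\ smooth_bmap g.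
Proof.
have entryl (t1 : triv V) (t2 : triv W) t i j x : tdom t1 x -> tdom t2 x ->
    tmap t x (copair_bmap f g x
      (frame (V := sum_bundle V W) (t1, t2) (lshift _ i) x)) 0 j =
    tmap t x (f x (frame t1 i x)) 0 j.
  by move=> *; rewrite sum_frame_lshift// copair_bmapE /= linear0 addr0.
have entryr (t1 : triv V) (t2 : triv W) t i j x : tdom t1 x -> tdom t2 x ->
    tmap t x (copair_bmap f g x
      (frame (V := sum_bundle V W) (t1, t2) (rshift _ i) x)) 0 j =
    tmap t x (g x (frame t2 i x)) 0 j.
  by move=> *; rewrite sum_frame_rshift// copair_bmapE /= linear0 add0r.
split=> [sfg|[sf sg] [t1 t2] t i j].
  split=> t t' i j; apply: smooth_on_local => x [tx t'x].
    have [s sx] := triv_cover W x.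
    exists (tdom t `&` tdom s `&` tdom t') => //.
    apply: smooth_on_eq (sfg (t, s) t' (lshift _ i) j).
      exact: (@entry_dom_open (sum_bundle V W) _ (t, s)).
    by move=> y [[? ?] ?]; exact: entryl.
  have [s sx] := triv_cover V x.
  exists (tdom s `&` tdom t `&` tdom t') => //.
  apply: smooth_on_eq (sfg (s, t) t' (rshift _ i) j).
    exact: (@entry_dom_open (sum_bundle V W) _ (s, t)).
  by move=> y [[? ?] ?]; exact: entryr.
have oD := @entry_dom_open (sum_bundle V W) _ (t1, t2) t.
case: (split_ordP i) => k ->.
  apply: (smooth_on_eq oD) (smooth_on_sub _ (sf t1 t k j)).
    by move=> y [[? ?] ?]; rewrite entryl.
  by move=> y [[? ?] ?].
apply: (smooth_on_eq oD) (smooth_on_sub _ (sg t2 t k j)).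
  by move=> y [[? ?] ?]; rewrite entryr.
by move=> y [[? ?] ?].
Qed.

Lemma smooth_bmapZ V W (a : R) (F : bmap V W) :
  smooth_bmap F -> smooth_bmap (fun x => a *: F x).
Proof.
move=> sF t t' i j.
apply: smooth_on_eq (smooth_onM (entry_dom_open t t')
  (smooth_on_cst _ a) (sF t t' i j)) => [|x _]; first exact: entry_dom_open.
by rewrite scale_lfunE linearZ mxE.
Qed.

Lemma smooth_bmapN V W (F : bmap V W) :
  smooth_bmap F -> smooth_bmap (fun x => - F x).
Proof.
move=> sF t t' i j.
by apply: smooth_on_ext (smooth_bmapZ (-1) sF t t' i j) => x; rewrite scaleN1r.
Qed.

End SmoothBundleMaps.

(** * Smoothness of a block matrix and of its blocks *)

Section Generalised.
Variables (R : realType) (n : nat) (M : manifold R n).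
Variable G : quadratic_lie_bundle M.
Local Notation T := (tangent_bundle M).
Local Notation Ts := (dual_bundle T).
Local Notation E := (courant_bundle G).

(** The matrix of [J^*] in the dual frames is the transpose of that of [J]. *)
Lemma smooth_adj_J (J : bmap T T) : smooth_bmap J -> smooth_bmap (adj_J G J).
Proof.
move=> sJ t t' i j.
have := sJ t' t j i; rewrite setIC; apply: smooth_on_eq.
  exact: (@entry_dom_open _ _ _ Ts Ts).
by move=> x [tx t'x]; rewrite [RHS]dual_trivE adj_JE dual_frameE.
Qed.

(** The factor 2 is that of the formulas for [nu^*] and [mu^*], whose entries
    these functions are. *)
Lemma smooth_qform_frame (V : vbundle M) (F : bmap V G) (t : triv G)
    (t' : triv V) i j : smooth_bmap F ->
  smooth_on (tdom t `&` tdom t')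
    (fun x => 2 * qform G x (frame t i x) (F x (frame t' j x))).
Proof.
move=> sF; have oD := entry_dom_open t t'.
apply: smooth_onM => //; first exact: smooth_on_cst.
pose f x := \sum_k tmap t x (F x (frame t' j x)) 0 k *
  dual_triv t x (qform G x (frame t i x)) 0 k.
apply: (@smooth_on_eq _ _ _ _ f) => // [x [tx _]|].
  rewrite [in RHS](frame_expand (F x _) tx) linear_sum.
  by apply: eq_bigr => k _; rewrite linearZ dual_trivE.
apply: smooth_on_sum => // k; apply: smooth_onM => //.
  by have := sF t' t j k; rewrite setIC.
by apply: smooth_on_sub (qform_smooth t t i k) => x [].
Qed.

Lemma smooth_adj_nu (nu : bmap Ts G) : smooth_bmap nu -> smooth_bmap (adj_nu nu).
Proof.
move=> snu t t' i j.
apply: (smooth_on_eq (entry_dom_open t t') _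
  (smooth_qform_frame (V := Ts) t t' i j snu)).
by move=> x [tx t'x]; rewrite -adj_nuE dual_frameE.
Qed.

Lemma smooth_adj_mu (mu : bmap T G) : smooth_bmap mu -> smooth_bmap (adj_mu mu).
Proof.
move=> smu t t' i j.
apply: (smooth_on_eq (entry_dom_open t t') _
  (smooth_qform_frame (V := T) t t' i j smu)).
by move=> x [tx t'x]; rewrite [RHS]dual_trivE adj_muE.
Qed.

Definition smooth_blocks (d : block_data G) : Prop :=
  [/\ smooth_bmap (dJ d), smooth_bmap (dA d) & smooth_bmap (dB d)] /\
  [/\ smooth_bmap (dnu d), smooth_bmap (dC d) & smooth_bmap (dmu d)].

(** The outer [copair_bmap] lists the columns of the block matrix, and each
    [pair_bmap] the rows of one column. *)
Lemma block_endo_columns (d : block_data G) :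
  block_endo G d = copair_bmap
    (copair_bmap (pair_bmap (pair_bmap (dJ d) (dC d)) (dmu d))
       (pair_bmap (pair_bmap (dB d) (fun x => - adj_J G (dJ d) x)) (dnu d)))
    (pair_bmap (pair_bmap (fun x => - adj_nu (dnu d) x)
                          (fun x => - adj_mu (dmu d) x)) (dA d)) :> bmap E E.
Proof.
case: d => J A B nu C mu /=.
set Js := fun x => - adj_J G J x; set nus := fun x => - adj_nu nu x.
set mus := fun x => - adj_mu mu x.
apply: functional_extensionality_dep => x; apply/lfunP => -[[X xi] r].
rewrite block_endoE !copair_bmapE /=.
rewrite (pair_bmapE (pair_bmap J C) mu X) (pair_bmapE (pair_bmap B Js) nu xi).
rewrite (pair_bmapE (pair_bmap nus mus) A r) !pair_bmapE.
by rewrite /Js /nus /mus !opp_lfunE.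
Qed.

Lemma smooth_block_endo (d : block_data G) :
  smooth_bmap (block_endo G d) <-> smooth_blocks d.
Proof.
rewrite block_endo_columns.
split=> [/smooth_copair[/smooth_copair[]]|[[sJ sA sB] [snu sC smu]]].
  move=> /smooth_pair[/smooth_pair[sJ sC] smu].
  move=> /smooth_pair[/smooth_pair[sB _] snu].
  by move=> /smooth_pair[_ sA].
apply/smooth_copair; split; first (apply/smooth_copair; split).
- by apply/smooth_pair; split=> //; apply/smooth_pair.
- apply/smooth_pair; split=> //; apply/smooth_pair; split=> //.
  exact/smooth_bmapN/smooth_adj_J.
- apply/smooth_pair; split=> //; apply/smooth_pair; split.
    exact/smooth_bmapN/smooth_adj_nu.
  exact/smooth_bmapN/smooth_adj_mu.
Qed.

(** * Skew-symmetry *)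

Definition skew_endo (I : bmap E E) : Prop :=
  forall x (u v : E x), courant_form (I x u) v = - courant_form u (I x v).

Lemma courant_form_sym x (u v : E x) : courant_form u v = courant_form v u.
Proof.
by congr (_ * _ + _); [exact: addrC | exact: qform_sym].
Qed.

Lemma inT_linear x : linear (@inT _ _ _ G x).
Proof. by move=> a u v; congr (_, _, _); rewrite /= scaler0 addr0. Qed.

Lemma inTs_linear x : linear (@inTs _ _ _ G x).
Proof. by move=> a u v; congr (_, _, _); rewrite /= scaler0 addr0. Qed.

Lemma inG_linear x : linear (@inG _ _ _ G x).
Proof. by move=> a u v; congr (_, _, _); rewrite /= scaler0 addr0. Qed.

Lemma courant_split x (u : E x) : u = inT G u.1.1 + inTs G u.1.2 + inG G u.2.
Proof.
by case: u => -[X xi] r; congr (_, _, _); rewrite /= ?addr0 ?add0r.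
Qed.

Lemma form_inT x (u : E x) (X : T x) : courant_form u (inT G X) = 2^-1 * u.1.2 X.
Proof. by rewrite /courant_form /= linear0 zero_lfunE add0r addr0. Qed.

Lemma form_inTs x (u : E x) (xi : Ts x) :
  courant_form u (inTs G xi) = 2^-1 * xi u.1.1.
Proof. by rewrite /courant_form /= !linear0 !addr0. Qed.

Lemma form_inG x (u : E x) (r : G x) : courant_form u (inG G r) = qform G x u.2 r.
Proof. by rewrite /courant_form /= linear0 zero_lfunE addr0 mulr0 add0r. Qed.

Lemma half_inj (a b : R) : 2^-1 * a = 2^-1 * b -> a = b.
Proof. by apply: mulfI; rewrite invr_eq0 pnatr_eq0. Qed.

Lemma lfun_courant_split x (F : 'Hom(E x, E x)) (u : E x) :
  F u = F (inT G u.1.1) + F (inTs G u.1.2) + F (inG G u.2).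
Proof. by rewrite [in LHS](courant_split u) (linearD F) (linearD F). Qed.

Lemma lfun_courant_eq x (F F' : 'Hom(E x, E x)) :
  (forall X, F (inT G X) = F' (inT G X)) ->
  (forall xi, F (inTs G xi) = F' (inTs G xi)) ->
  (forall r, F (inG G r) = F' (inG G r)) -> F = F'.
Proof.
move=> FT FTs FG; apply/lfunP => u.
by rewrite (lfun_courant_split F) (lfun_courant_split F') FT FTs FG.
Qed.

Lemma block_endo_inT (d : block_data G) x (X : T x) :
  block_endo G d x (inT G X) = (dJ d x X, dC d x X, dmu d x X).
Proof.
by rewrite block_endoE; case: d => * /=; rewrite !linear0 !(subr0, addr0).
Qed.

Lemma block_endo_inTs (d : block_data G) x (xi : Ts x) :
  block_endo G d x (inTs G xi) =
  (dB d x xi, - adj_J G (dJ d) x xi, dnu d x xi).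
Proof.
by rewrite block_endoE; case: d => * /=; rewrite !linear0 !(subr0, addr0, add0r).
Qed.

Lemma block_endo_inG (d : block_data G) x (r : G x) :
  block_endo G d x (inG G r) =
  (- adj_nu (dnu d) x r, - adj_mu (dmu d) x r, dA d x r).
Proof.
by rewrite block_endoE; case: d => * /=; rewrite !linear0 !(subr0, add0r).
Qed.

Lemma block_endo_inj : injective (@block_endo R n M G).
Proof.
move=> d d' dd'.
have eT x X : block_endo G d x (inT G X) = block_endo G d' x (inT G X).
  by rewrite dd'.
have eTs x xi : block_endo G d x (inTs G xi) = block_endo G d' x (inTs G xi).
  by rewrite dd'.
have eG x r : block_endo G d x (inG G r) = block_endo G d' x (inG G r).
  by rewrite dd'.
have eJ : dJ d = dJ d'.
  apply: functional_extensionality_dep => x; apply/lfunP => X.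
  by have := eT x X; rewrite !block_endo_inT => -[].
have eC : dC d = dC d'.
  apply: functional_extensionality_dep => x; apply/lfunP => X.
  by have := eT x X; rewrite !block_endo_inT => -[].
have emu : dmu d = dmu d'.
  apply: functional_extensionality_dep => x; apply/lfunP => X.
  by have := eT x X; rewrite !block_endo_inT => -[].
have eB : dB d = dB d'.
  apply: functional_extensionality_dep => x; apply/lfunP => xi.
  by have := eTs x xi; rewrite !block_endo_inTs => -[].
have enu : dnu d = dnu d'.
  apply: functional_extensionality_dep => x; apply/lfunP => xi.
  by have := eTs x xi; rewrite !block_endo_inTs => -[].
have eA : dA d = dA d'.
  apply: functional_extensionality_dep => x; apply/lfunP => r.
  by have := eG x r; rewrite !block_endo_inG => -[].
case: d d' eJ eC emu eB enu eA {dd' eT eTs eG} => ? ? ? ? ? ? [? ? ? ? ? ?] /=.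
by do 6 move=> ->.
Qed.

Lemma skew_swap (I : bmap E E) x (u v : E x) : skew_endo I ->
  courant_form (I x u) v = - courant_form (I x v) u.
Proof. by move=> sI; rewrite sI courant_form_sym. Qed.

Definition skew_blocks (d : block_data G) : Prop :=
  [/\ forall x, adj_B G (dB d) x = - dB d x,
      forall x, adj_C G (dC d) x = - dC d x &
      forall x, adj_A (dA d) x = - dA d x].

(** The terms of the two sides that involve [J], [nu], [mu] and their adjoints
    always match; what is left is skew-symmetry of [B], [C] and [A]. *)
Lemma skew_block_endo (d : block_data G) :
  skew_endo (block_endo G d) <-> skew_blocks d.
Proof.
case: d => J A B nu C mu; rewrite /skew_blocks /=; split=> [sI|[sB sC sA]].
  split=> x; apply/lfunP => u; rewrite opp_lfunE.
  - apply/eqP; rewrite -subr_eq0 opprK; apply/eqP/functional_sep => eta.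
    rewrite linearD /= adj_BE; apply/eqP; rewrite addr_eq0; apply/eqP/half_inj.
    have := skew_swap (inTs G eta) (inTs G u) sI.
    by rewrite !form_inTs !block_endo_inTs mulrN.
  - apply/lfunP => Y; rewrite adj_CE opp_lfunE; apply/half_inj.
    have := skew_swap (inT G Y) (inT G u) sI.
    by rewrite !form_inT !block_endo_inT mulrN.
  - apply/eqP; rewrite -subr_eq0 opprK; apply/eqP/qform_nondegenerate => s.
    rewrite linearD /= add_lfunE adj_AE qform_sym; apply/eqP.
    rewrite addr_eq0; apply/eqP.
    have := skew_swap (inG G s) (inG G u) sI.
    by rewrite !form_inG !block_endo_inG.
move=> x [[X xi] r] [[Y eta] s]; rewrite /courant_form !block_endoE /=.
have hB : eta (B x xi) = - xi (B x eta).
  by rewrite -(adj_BE G B) sB opp_lfunE linearN.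
have hC : C x X Y = - C x Y X.
  by rewrite -(adj_CE G C X) sC opp_lfunE opp_lfunE opprK.
have hA : qform G x (A x r) s = - qform G x r (A x s).
  by rewrite -adj_AE sA opp_lfunE linearN opp_lfunE opprK.
rewrite !(linearB, linearD) /= !add_lfunE !opp_lfunE.
rewrite !(adj_JE, adj_muE, adj_nuE) hA hB hC.
rewrite (qform_sym (mu x X)) (qform_sym (nu x xi)).
lra.
Qed.

(** The free blocks are read off from [I]; skew-symmetry identifies the other
    three with the adjoints prescribed by the block matrix. *)
Lemma skew_endo_block_endo (I : bmap E E) :
  skew_endo I -> exists d, block_endo G d = I.
Proof.
move=> sI.
pose J : bmap T T := fun x => linfun (fun X => (I x (inT G X)).1.1).
pose C : bmap T Ts := fun x => linfun (fun X => (I x (inT G X)).1.2).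
pose mu : bmap T G := fun x => linfun (fun X => (I x (inT G X)).2).
pose B : bmap Ts T := fun x => linfun (fun xi => (I x (inTs G xi)).1.1).
pose nu : bmap Ts G := fun x => linfun (fun xi => (I x (inTs G xi)).2).
pose A : bmap G G := fun x => linfun (fun r => (I x (inG G r)).2).
have JE x X : J x X = (I x (inT G X)).1.1.
  by apply: linfun_linearE => a u v; rewrite inT_linear linearP.
have CE x X : C x X = (I x (inT G X)).1.2.
  by apply: linfun_linearE => a u v; rewrite inT_linear linearP.
have muE x X : mu x X = (I x (inT G X)).2.
  by apply: linfun_linearE => a u v; rewrite inT_linear linearP.
have BE x xi : B x xi = (I x (inTs G xi)).1.1.
  by apply: linfun_linearE => a u v; rewrite inTs_linear linearP.
have nuE x xi : nu x xi = (I x (inTs G xi)).2.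
  by apply: linfun_linearE => a u v; rewrite inTs_linear linearP.
have AE x r : A x r = (I x (inG G r)).2.
  by apply: linfun_linearE => a u v; rewrite inG_linear linearP.
pose d := BlockData J A B nu C mu; exists d.
apply: functional_extensionality_dep => x.
apply: (@lfun_courant_eq x (block_endo G d x) (I x)) => [X|xi|r]; rewrite /d.
- by rewrite block_endo_inT /= JE CE muE; case: (I x _) => [[]].
- rewrite block_endo_inTs /= BE nuE.
  rewrite (_ : - adj_J G J x _ = (I x (inTs G xi)).1.2).
    by case: (I x _) => [[]].
  apply/lfunP => Y; apply: half_inj.
  by rewrite -form_inT skew_swap// form_inTs -JE opp_lfunE adj_JE mulrN.
- rewrite block_endo_inG /= AE.
  rewrite (_ : - adj_nu nu x _ = (I x (inG G r)).1.1); last first.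
    apply/eqP; rewrite -subr_eq0; apply/eqP/functional_sep => eta.
    rewrite linearB linearN /= adj_nuE; apply/eqP; rewrite subr_eq0.
    apply/eqP/half_inj; rewrite -form_inTs skew_swap// form_inG -nuE.
    by rewrite qform_sym mulrN mulrA mulVf ?mul1r// pnatr_eq0.
  rewrite (_ : - adj_mu mu x _ = (I x (inG G r)).1.2).
    by case: (I x _) => [[]].
  apply/lfunP => Y; apply: half_inj.
  rewrite -form_inT skew_swap// form_inG -muE opp_lfunE adj_muE.
  by rewrite qform_sym mulrN mulrA mulVf ?mul1r// pnatr_eq0.
Qed.

(** * The square *)

Definition square_blocks (d : block_data G) : Prop :=
  let: BlockData J A B nu C mu := d in
  let Js := adj_J G J in let nus := adj_nu nu in let mus := adj_mu mu in
  ([/\ forall x, (J x \o J x) + (B x \o C x) - (nus x \o mu x) = - \1,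
      forall x, - (mu x \o nus x) - (nu x \o mus x) + (A x \o A x) = - \1 &
      forall x, (J x \o B x) - (B x \o Js x) - (nus x \o nu x) = 0]%VF /\
  [/\ forall x, (mu x \o B x) - (nu x \o Js x) + (A x \o nu x) = 0,
      forall x, (C x \o J x) - (Js x \o C x) - (mus x \o mu x) = 0 &
      forall x, (mu x \o J x) + (nu x \o C x) + (A x \o mu x) = 0]%VF).

Lemma skew_square_adjoint (I : bmap E E) x (u v : E x) : skew_endo I ->
  courant_form (I x (I x u)) v = courant_form u (I x (I x v)).
Proof. by move=> sI; rewrite !sI opprK. Qed.

Let lfunCE := (add_lfunE, opp_lfunE, comp_lfunE, id_lfunE, zero_lfunE).

(** The columns are treated in the order T, T^*, G: for T all three equations
    are given; for T^* and G the missing components are found by pairing with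
    the summands already treated, [I^2] being self-adjoint. *)
Lemma square_block_endo (d : block_data G) : skew_endo (block_endo G d) ->
  (forall x, (block_endo G d x \o block_endo G d x = - \1)%VF) <->
  square_blocks d.
Proof.
move=> sI; pose I := block_endo G d.
have sq0 x : (I x \o I x = - \1)%VF <-> forall u : E x, I x (I x u) = - u.
  split=> [sq u|sq]; last by apply/lfunP => u; rewrite !lfunCE.
  by rewrite -comp_lfunE sq !lfunCE.
have sqT x X : I x (I x (inT G X)) =
    block_fun d (dJ d x X, dC d x X, dmu d x X).
  by rewrite /I block_endo_inT block_endoE.
have sqTs x xi : I x (I x (inTs G xi)) =
    block_fun d (dB d x xi, - adj_J G (dJ d) x xi, dnu d x xi).
  by rewrite /I block_endo_inTs block_endoE.
have sqG x r : I x (I x (inG G r)) =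
    block_fun d (- adj_nu (dnu d) x r, - adj_mu (dmu d) x r, dA d x r).
  by rewrite /I block_endo_inG block_endoE.
have adjI x (u v : E x) :
    courant_form (I x (I x u)) v = courant_form (I x (I x v)) u.
  by rewrite skew_square_adjoint// courant_form_sym.
rewrite -/I; move: (I) sq0 sqT sqTs sqG adjI => {sI}I.
case: d => J A B nu C mu /= sq0 sqT sqTs sqG adjI.
split=> [sq|[[eJ eA eB] [enu eC emu]] x].
  have {}sq x := (sq0 x).1 (sq x).
  split; split=> x; apply/lfunP => u; rewrite !lfunCE.
  - have := congr1 (fun w : E x => w.1.1) (etrans (esym (sqT x u)) (sq x _)).
    exact.
  - have := congr1 (fun w : E x => w.2) (etrans (esym (sqG x u)) (sq x _)).
    by rewrite /= !linearN.
  - have := congr1 (fun w : E x => w.1.1) (etrans (esym (sqTs x u)) (sq x _)).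
    by rewrite /= !linearN oppr0.
  - have := congr1 (fun w : E x => w.2) (etrans (esym (sqTs x u)) (sq x _)).
    by rewrite /= !linearN oppr0.
  - have := congr1 (fun w : E x => w.1.2) (etrans (esym (sqT x u)) (sq x _)).
    by rewrite /= oppr0.
  - have := congr1 (fun w : E x => w.2) (etrans (esym (sqT x u)) (sq x _)).
    by rewrite /= oppr0.
have pair3 (a a' : T x) (b b' : Ts x) (c c' : G x) :
    a = a' -> b = b' -> c = c' -> (a, b, c) = (a', b', c') :> E x.
  by move=> -> -> ->.
have IT X : I x (I x (inT G X)) = - inT G X.
  rewrite sqT; apply: pair3; rewrite -?opp_lfunE ?oppr0.
  - by have /lfunP/(_ X) := eJ x; rewrite !lfunCE.
  - by have /lfunP/(_ X) := eC x; rewrite !lfunCE.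
  - by have /lfunP/(_ X) := emu x; rewrite !lfunCE.
have ITs xi : I x (I x (inTs G xi)) = - inTs G xi.
  rewrite sqTs; apply: pair3; rewrite ?oppr0.
  - by have /lfunP/(_ xi) := eB x; rewrite !lfunCE linearN.
  - (* the equation from T^* to T^*, adjoint to the one from T to T *)
    apply/lfunP => Y; apply: half_inj.
    have := adjI x (inTs G xi) (inT G Y).
    rewrite form_inT IT form_inTs sqTs /= => ->.
    by rewrite linearN opp_lfunE.
  - by have /lfunP/(_ xi) := enu x; rewrite !lfunCE linearN.
have IG r : I x (I x (inG G r)) = - inG G r.
  rewrite sqG; apply: pair3; rewrite ?oppr0.
  - (* the equation from G to T, adjoint to the one from T^* to G *)
    apply: functional_sep => eta; apply: half_inj.
    have := adjI x (inG G r) (inTs G eta).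
    rewrite form_inTs ITs form_inG sqG /= => ->.
    by rewrite oppr0 linear0 zero_lfunE mulr0.
  - (* the equation from G to T^*, adjoint to the one from T to G *)
    apply/lfunP => Y; apply: half_inj.
    have := adjI x (inG G r) (inT G Y).
    rewrite form_inT IT form_inG sqG /= => ->.
    by rewrite oppr0 linear0 !zero_lfunE mulr0.
  - by have /lfunP/(_ r) := eA x; rewrite !lfunCE !linearN.
apply: (@lfun_courant_eq x (I x \o I x)%VF (- \1)%VF) => u; rewrite !lfunCE.
- exact: IT.
- exact: ITs.
- exact: IG.
Qed.

(** * The correspondence *)

Lemma block_admissibleE (d : block_data G) : block_admissible G d <->
  [/\ smooth_blocks d, skew_blocks d & square_blocks d].
Proof.
by case: d => J A B nu C mu; split=> [[sm sk q1 q2]|[sm sk [q1 q2]]]; split.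
Qed.

Lemma gen_almost_complex_blocks (d : block_data G) :
  gen_almost_complex G (block_endo G d) <-> block_admissible G d.
Proof.
split=> [[sm sk sq]|/block_admissibleE[sm sk sq]].
  apply/block_admissibleE; split.
  - exact/smooth_block_endo.
  - exact/skew_block_endo.
  - exact/square_block_endo.
have {}sk := (skew_block_endo d).2 sk.
split; [exact/smooth_block_endo | exact: sk | exact/square_block_endo].
Qed.

End Generalised.

Theorem lemma2 (R : realType) (n : nat) (M : manifold R n)
    (G : quadratic_lie_bundle M)
    (M_connected : connected [set: M])
    (E_neutral : forall x : M,
      @neutral_signature R (courant_bundle G x) (@courant_form R n M G x)) :
  set_bij [set d : block_data G | block_admissible G d]
          [set I : bmap (courant_bundle G) (courant_bundle G) |
             gen_almost_complex G I]
          (block_endo G).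
Proof.
split=> [d /gen_almost_complex_blocks//|d d' _ _|I gacI].
  exact: block_endo_inj.
have [_ skI _] := gacI; have [d dI] := skew_endo_block_endo skI.
by exists d => //; apply/gen_almost_complex_blocks; rewrite dI.
Qed.
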